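(* Every full coset relation algebra is isomorphic to a direct product of full coset relation algebras on simple semi-frames (each satisfying the coset conditions).
   Context: **Group triples.** Let $I$ be a set, $\mathcal E$ an equivalence relation on $I$, $\mathcal E_3=\{(x,y,z):(x,y),(y,z)\in\mathcal E\}$, and $\mathcal E_4=\{(x,y,z,w):(x,y),(x,z),(x,w)\in\mathcal E\}$. A group triple $\mathcal F=(G,\varphi,C)$ consists of pairwise disjoint groups $G_x$ ($x\in I$) with operation $\circ$ and identity $e_x$; for each $(x,y)\in\mathcal E$ an isomorphism $\varphi_{xy}:G_x/H_{xy}\to G_y/K_{xy}$, where $H_{xy}\trianglelefteq G_x$ and $K_{xy}\trianglelefteq G_y$ are determined by $\varphi_{xy}$; and for each $(x,y,z)\in\mathcal E_3$ a coset $C_{xyz}$ of the normal subgroup $H_{xy}\circ H_{xz}$ in $G_x$. For subsets $X,Y$ of a group, $X\circ Y=\{a\circ b:a\in X,b\in Y\}$ and $X^{-1}=\{a^{-1}:a\in X\}$. If $Q\subseteq G_x$ is a union of cosets of $H_{xy}$, then $\varphi_{xy}[Q]$ is the union of the sets $\varphi_{xy}(D)$ over cosets $D\subseteq Q$ of $H_{xy}$; $\varphi_{xy}^{-1}[Q]$ is defined similarly for unions $Q$ of cosets of $K_{xy}$. **Semi-frames.** $\mathcal F$ is a semi-frame if: (i) $\varphi_{xx}$ is the identity automorphism of $G_x/\{e_x\}$ (so $H_{xx}=K_{xx}=\{e_x\}$) for all $x\in I$; (ii) $\varphi_{yx}=\varphi_{xy}^{-1}$ for all $(x,y)\in\mathcal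 E$ (so $H_{yx}=K_{xy}$); (iii) $\varphi_{xy}[H_{xy}\circ H_{xz}]=K_{xy}\circ H_{yz}$ for all $(x,y,z)\in\mathcal E_3$; (iv) for all $(x,y,z)\in\mathcal E_3$ and all cosets $D$ of $H_{xy}\circ H_{xz}$, $\varphi_{yz}[\varphi_{xy}[D]]=\varphi_{xz}[C_{xyz}^{-1}\circ D\circ C_{xyz}]$. The semi-frame is simple if $I\neq\varnothing$ and $\mathcal E=I\times I$. **Coset conditions.** (1) $C_{xyy}=H_{xy}$ for all $(x,y)\in\mathcal E$; (2) $\varphi_{xz}[C_{xyz}]=C_{zyx}^{-1}$ and (3) $\varphi_{xy}[C_{xyz}]=C_{yxz}^{-1}$ for all $(x,y,z)\in\mathcal E_3$; (4) $C_{xyz}\circ C_{xzw}=\varphi_{yx}[C_{yzw}\circ H_{yx}]\circ C_{xyw}$ for all $(x,y,z,w)\in\mathcal E_4$. **The algebra $\mathfrak C[\mathcal F]$.** For each $(x,y)\in\mathcal E$ fix an enumeration without repetitions $\langle H_{xy,\gamma}:\gamma<\kappa_{xy}\rangle$ of the cosets of $H_{xy}$ in $G_x$ with $H_{xy,0}=H_{xy}$, and put $K_{xy,\gamma}=\varphi_{xy}(H_{xy,\gamma})$; the enumerations are chosen so that $\kappa_{yx}=\kappa_{xy}$ and $H_{yx,\gamma}=K_{xy,\gamma}$. For $\alpha<\kappa_{xy}$ let $R_{xy,\alpha}=\bigcup_{\gamma<\kappa_{xy}}H_{xy,\gamma}\times(K_{xy,\gamma}\circ K_{xy,\alpha})$.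 Let $U=\bigcup_{x\in I}G_x$, $E=\bigcup\{G_x\times G_y:(x,y)\in\mathcal E\}$, and let $A$ be the collection of all unions of sets of relations $R_{xy,\alpha}$ ($(x,y)\in\mathcal E$, $\alpha<\kappa_{xy}$). Define $\otimes$ on $A$ by $R_{xy,\alpha}\otimes R_{yz,\beta}=\bigcup\{R_{xz,\gamma}:H_{xz,\gamma}\subseteq\varphi_{xy}^{-1}[K_{xy,\alpha}\circ H_{yz,\beta}]\circ C_{xyz}\}$, $R_{xy,\alpha}\otimes R_{wz,\beta}=\varnothing$ if $y\ne w$, and complete distributivity over arbitrary unions. Then $\mathfrak C[\mathcal F]=\langle A,\cup,\sim,\otimes,{}^{-1},\mathrm{id}_U\rangle$, where $\sim$ is complement relative to $E$ and ${}^{-1}$ is relational converse. When $\mathcal F$ is a semi-frame satisfying the coset conditions, $\mathfrak C[\mathcal F]$ is a relation algebra, called the full coset relation algebra on $\mathcal F$. The product of the empty family of algebras is the one-element algebra. *)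

(* Defs.v *)
From HB Require Import structures.
From mathcomp Require Import all_boot.
From mathcomp Require Import boolp classical_sets functions wochoice.
From Stdlib Require Import RelationClasses.

Set Implicit Arguments.
Unset Strict Implicit.
Unset Printing Implicit Defensive.

Local Open Scope classical_set_scope.

Definition mulS (G : groupType) (X Y : set G) : set G :=
  [set c | exists a b, [/\ X a, Y b & c = (a * b)%g]].
Notation "X ∘ Y" := (mulS X Y) (at level 40, left associativity)
  : classical_set_scope.

Definition invS (G : groupType) (X : set G) : set G :=
  [set (a^-1)%g | a in X].

Definition normal_subgroup (G : groupType) (N : set G) : Prop :=
  [/\ N 1%g,
      forall a b, N a -> N b -> N (a * b)%g,
      forall a, N a -> N (a^-1)%g
    & forall a g, N a -> N (a ^ g)%g].

Definition coset_by (G : groupType) (N : set G) (a : G) : set G :=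
  [set (a * n)%g | n in N].

Definition cosets (G : groupType) (N : set G) : set (set G) :=
  range (coset_by N).

(* An isomorphism from G / N onto G' / N'.  The elements of G / N are the
   cosets of N as sets, multiplied by the complex product; the values of f
   outside cosets N are irrelevant. *)
Definition quotient_iso (G G' : groupType) (N : set G) (N' : set G')
    (f : set G -> set G') : Prop :=
  set_bij (cosets N) (cosets N') f /\
  (forall D D', cosets N D -> cosets N D' -> f (D ∘ D') = f D ∘ f D').

(* The groups form a family of types, so they are pairwise disjoint by
   construction; their union is the tagged union carrierU.  The components
   subH, subK, phi and cosC are total functions, but only their values at
   indices related by relE are constrained and used. *)
Record group_triple := GroupTriple {
  idx : Type;
  relE : idx -> idx -> Prop;
  grp : idx -> groupType;
  subH : forall x y : idx, set (grp x);
  subK : forall x y : idx, set (grp y);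
  phi : forall x y : idx, set (grp x) -> set (grp y);
  cosC : forall x y z : idx, set (grp x);
  E_equiv : Equivalence relE;
  H_normal : forall x y, relE x y -> normal_subgroup (@subH x y);
  K_normal : forall x y, relE x y -> normal_subgroup (@subK x y);
  phi_iso : forall x y, relE x y ->
    quotient_iso (@subH x y) (@subK x y) (@phi x y);
  C_coset : forall x y z, relE x y -> relE y z ->
    cosets (@subH x y ∘ @subH x z) (@cosC x y z) }.

Arguments relE : clear implicits.
Arguments grp : clear implicits.
Arguments subH : clear implicits.
Arguments subK : clear implicits.
Arguments phi : clear implicits.
Arguments cosC : clear implicits.

Section GroupTripleDefs.
Variable F : group_triple.
Implicit Types x y z w : idx F.

Definition phi_image x y (Q : set (grp F x)) : set (grp F y) :=
  \bigcup_(D in [set D | cosets (subH F x y) D /\ D `<=` Q]) phi F x y D.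
Arguments phi_image : clear implicits.

Definition phi_preimage x y (Q : set (grp F y)) : set (grp F x) :=
  \bigcup_(D in [set D | cosets (subH F x y) D /\ phi F x y D `<=` Q]) D.
Arguments phi_preimage : clear implicits.

Definition semi_frame : Prop :=
  [/\ forall x, [/\ subH F x x = [set 1%g], subK F x x = [set 1%g]
        & forall D, cosets [set 1%g] D -> phi F x x D = D],
      forall x y, relE F x y ->
        [/\ subH F y x = subK F x y, subK F y x = subH F x y
        & forall D, cosets (subH F x y) D -> phi F y x (phi F x y D) = D],
      forall x y z, relE F x y -> relE F y z ->
        phi_image x y (subH F x y ∘ subH F x z) = subK F x y ∘ subH F y z
    & forall x y z, relE F x y -> relE F y z ->
        forall D, cosets (subH F x y ∘ subH F x z) D ->
        phi_image y z (phi_image x y D) =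
        phi_image x z (invS (cosC F x y z) ∘ D ∘ cosC F x y z)].

Definition coset_conditions : Prop :=
  [/\ forall x y, relE F x y -> cosC F x y y = subH F x y,
      forall x y z, relE F x y -> relE F y z ->
        phi_image x z (cosC F x y z) = invS (cosC F z y x),
      forall x y z, relE F x y -> relE F y z ->
        phi_image x y (cosC F x y z) = invS (cosC F y x z)
    & forall x y z w, relE F x y -> relE F x z -> relE F x w ->
        cosC F x y z ∘ cosC F x z w =
        phi_image y x (cosC F y z w ∘ subH F y x) ∘ cosC F x y w].

Definition simple : Prop :=
  [set: idx F] !=set0 /\ (forall x y, relE F x y).

End GroupTripleDefs.

Arguments phi_image : clear implicits.
Arguments phi_preimage : clear implicits.

(* A choice of enumerations of the cosets.  The ordinals kappa_xy are
   represented as initial segments of one well-ordered set with least element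
   ord_zero. *)
Record coset_enumeration (F : group_triple) := CosetEnumeration {
  ord : Type;
  ord_le : rel ord;
  ord_zero : ord;
  kappa : idx F -> idx F -> set ord;
  enumH : forall x y : idx F, ord -> set (grp F x);
  ord_wo : well_order ord_le;
  ord_zero_le : forall a, ord_le ord_zero a;
  kappa_initial : forall x y a b,
    ord_le b a -> kappa x y a -> kappa x y b;
  enumH_bij : forall x y, relE F x y ->
    set_bij (kappa x y) (cosets (subH F x y)) (@enumH x y);
  enumH_zero : forall x y, relE F x y -> @enumH x y ord_zero = subH F x y;
  kappa_sym : forall x y, relE F x y -> kappa y x = kappa x y;
  enumH_sym : forall x y a, relE F x y -> kappa x y a ->
    @enumH y x a = phi F x y (@enumH x y a) }.

Arguments ord_zero {F} c.
Arguments kappa {F} c x y.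
Arguments enumH {F} c x y a.

Section CosetRelations.
Variables (F : group_triple) (en : coset_enumeration F).
Implicit Types (x y z w : idx F) (a b c : ord en).

Definition carrierU : Type := {x : idx F & grp F x}.

Definition inU x (X : set (grp F x)) : set carrierU :=
  [set existT (grp F) x g | g in X].

Definition unitE : set (carrierU * carrierU) :=
  [set p | relE F (projT1 p.1) (projT1 p.2)].

Definition enumK x y a : set (grp F y) := phi F x y (enumH en x y a).
Arguments enumK : clear implicits.

Definition relR x y a : set (carrierU * carrierU) :=
  \bigcup_(c in kappa en x y)
    (inU (enumH en x y c) `*` inU (enumK x y c ∘ enumK x y a)).

Definition basic : set (set (carrierU * carrierU)) :=
  [set r | exists x y a, [/\ relE F x y, kappa en x y a & r = relR x y a]].

Definition algA : set (set (carrierU * carrierU)) :=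
  [set S | exists2 X, X `<=` basic & S = \bigcup_(r in X) r].

(* The product of relR x y a and relR y z b. *)
Definition otimes_basic x y z a b : set (carrierU * carrierU) :=
  \bigcup_(c in [set c | kappa en x z c /\
      enumH en x z c `<=`
        phi_preimage F x y (enumK x y a ∘ enumH en y z b) ∘ cosC F x y z])
    relR x z c.

(* The completely distributive extension of the rules for basic relations:
   see otimes_RR, otimes_RR0 and otimes_bigcup. *)
Definition otimes (S T : set (carrierU * carrierU)) :
    set (carrierU * carrierU) :=
  [set p | exists x y z a b,
    [/\ [/\ relE F x y, relE F y z, kappa en x y a & kappa en y z b],
        relR x y a `<=` S, relR y z b `<=` T & otimes_basic x y z a b p]].

End CosetRelations.

Arguments enumK {F} en x y a.
Arguments relR {F} en x y a.
Arguments otimes_basic {F} en x y z a b.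
Arguments basic : clear implicits.
Arguments algA : clear implicits.
Arguments otimes : clear implicits.

Section CosetTheory.
Variable G : groupType.
Variable N : set G.
Hypothesis nN : normal_subgroup N.

Lemma coset_byP a b : coset_by N a b <-> N (a^-1 * b)%g.
Proof.
split; first by case=> n Nn <-; rewrite mulKg.
by move=> h; exists (a^-1 * b)%g; rewrite // mulVKg.
Qed.

Lemma coset_by_refl a : coset_by N a a.
Proof. by apply/coset_byP; rewrite mulVg; case: nN. Qed.

Lemma coset_by_eq a b : coset_by N a b -> coset_by N a = coset_by N b.
Proof.
case: nN => _ NM NV _ [n Nn <-]; apply/seteqP; split=> c /coset_byP h;
  apply/coset_byP; rewrite ?invgM.
  by rewrite -mulgA; apply: NM => //; apply: NV.
have := NM _ _ Nn h; by rewrite invgM -mulgA mulVKg.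
Qed.

Lemma coset_byM a b : coset_by N a ∘ coset_by N b = coset_by N (a * b)%g.
Proof.
case: nN => N1 NM NV NJ; apply/seteqP; split=> c.
  case=> _ [_ [[m Nm <-] [n Nn <-] ->]]; exists ((m ^ b) * n)%g.
    by apply: NM => //; apply: NJ.
  by rewrite /conjg !mulgA mulgK.
case=> n Nn <-; exists a, (b * n)%g; split; last by rewrite mulgA.
  exact: coset_by_refl.
by exists n.
Qed.

Lemma cosets_coset D a : cosets N D -> D a -> D = coset_by N a.
Proof. by move=> [b _ <-]; apply: coset_by_eq. Qed.

Lemma coset_by_cosets a : cosets N (coset_by N a).
Proof. by exists a. Qed.

Lemma cosets1 : cosets N N.
Proof.
exists 1%g => //; apply/seteqP; split=> c; first by case=> n Nn <-; rewrite mul1g.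
by move=> Nc; exists c; rewrite // mul1g.
Qed.

Lemma cosetsM D D' : cosets N D -> cosets N D' -> cosets N (D ∘ D').
Proof.
by move=> [a _ <-] [b _ <-]; rewrite coset_byM; apply: coset_by_cosets.
Qed.

End CosetTheory.

Section CosetRelationTheory.
Variables (F : group_triple) (en : coset_enumeration F).
Implicit Types (x y z w : idx F) (a b c : ord en).

Lemma existT_inj x (g h : grp F x) :
  existT (grp F) x g = existT (grp F) x h -> g = h.
Proof.
move=> e; have /= := projT2_eq e.
by rewrite (Prop_irrelevance (projT1_eq e) erefl).
Qed.

Lemma inUE x (X : set (grp F x)) g : inU X (existT (grp F) x g) <-> X g.
Proof.
split=> [[h Xh /existT_inj <-//]|Xg]; by exists g.
Qed.

Lemma R_tag x y a p : relR en x y a p ->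
  projT1 p.1 = x /\ projT1 p.2 = y.
Proof.
by case: p => p q [c _ [/= [g _ <-] [h _ <-]]].
Qed.

Lemma enumH_coset x y a : relE F x y -> kappa en x y a ->
  cosets (subH F x y) (enumH en x y a).
Proof. by move=> Exy ka; have [h _ _] := enumH_bij en Exy; apply: h. Qed.

Lemma phi_coset x y D : relE F x y -> cosets (subH F x y) D ->
  cosets (subK F x y) (phi F x y D).
Proof. by move=> Exy cD; have [[h _ _] _] := phi_iso Exy; apply: h. Qed.

Lemma enumK_coset x y a : relE F x y -> kappa en x y a ->
  cosets (subK F x y) (enumK en x y a).
Proof. by move=> Exy ka; apply: phi_coset => //; apply: enumH_coset. Qed.

Lemma phi_inj x y D D' : relE F x y -> cosets (subH F x y) D ->
  cosets (subH F x y) D' -> phi F x y D = phi F x y D' -> D = D'.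
Proof.
by move=> Exy cD cD' e; have [[_ h _] _] := phi_iso Exy; apply: h;
  rewrite ?inE.
Qed.

Lemma enumK_inj x y a b : relE F x y -> kappa en x y a -> kappa en x y b ->
  enumK en x y a = enumK en x y b -> a = b.
Proof.
move=> Exy ka kb /phi_inj e; have [_ h _] := enumH_bij en Exy.
by apply: h; rewrite ?inE //; apply: e => //; apply: enumH_coset.
Qed.

Lemma RP x y a g h : relE F x y -> kappa en x y a ->
  relR en x y a (existT (grp F) x g, existT (grp F) y h) <->
  (phi F x y (coset_by (subH F x y) g) ∘ enumK en x y a) h.
Proof.
move=> Exy ka; have nH := H_normal Exy; split.
  case=> c kc [/inUE Hg /inUE].
  by rewrite -(cosets_coset nH (enumH_coset Exy kc) Hg).
have [_ _ /(_ _ (coset_by_cosets (subH F x y) g)) [c kc e]] := enumH_bij en Exy.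
rewrite -e => Kh; exists c => //; split; apply/inUE => //=.
by rewrite e; apply: coset_by_refl.
Qed.

Lemma R_cover p : unitE p -> exists2 r, basic F en r & r p.
Proof.
case: p => -[x g] [y h]; rewrite /unitE /= => Exy.
have nK := K_normal Exy; have [[f _ s] _] := phi_iso Exy.
have [c _ ec] := f _ (coset_by_cosets (subH F x y) g).
have [D cD eD] := s _ (coset_by_cosets (subK F x y) (c^-1 * h)%g).
have [_ _ /(_ _ cD) [a ka ea]] := enumH_bij en Exy.
exists (relR en x y a); first by exists x, y, a.
apply/RP => //; rewrite -ec /enumK ea eD coset_byM // mulVKg.
exact: coset_by_refl.
Qed.

Lemma R_unitE x y a : relE F x y -> relR en x y a `<=` @unitE F.
Proof. by move=> Exy p /R_tag [ex ey]; rewrite /unitE /= ex ey. Qed.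

Lemma R_disj x y a b p : relE F x y -> kappa en x y a -> kappa en x y b ->
  relR en x y a p -> relR en x y b p -> a = b.
Proof.
move=> Exy ka kb Rp; have [ex ey] := R_tag Rp.
case: p ex ey Rp => -[x' g] [y' h] /= ex ey; subst x' y'.
move=> /(RP _ _ Exy ka) + /(RP _ _ Exy kb).
have nK := K_normal Exy.
have [c _ <-] := phi_coset Exy (coset_by_cosets (subH F x y) g).
have [d _ ed] := enumK_coset Exy ka; have [d' _ ed'] := enumK_coset Exy kb.
rewrite -ed -ed' !coset_byM // => h1 h2.
apply: (enumK_inj Exy ka kb); rewrite -ed -ed'; apply: coset_by_eq => //.
have : coset_by (subK F x y) (c * d)%g (c * d')%g.
  by rewrite (coset_by_eq nK h1) -(coset_by_eq nK h2); apply: coset_by_refl.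
move/coset_byP => h3; apply/coset_byP.
by move: h3; rewrite invgM -mulgA mulKg.
Qed.

Lemma basic_disj r r' p : basic F en r -> basic F en r' -> r p -> r' p ->
  r = r'.
Proof.
case=> x [y [a [Exy ka ->]]] [x' [y' [a' [Exy' ka' ->]]]] Rp Rp'.
have [ex ey] := R_tag Rp; have [ex' ey'] := R_tag Rp'.
have ? : x' = x by rewrite -ex.
have ? : y' = y by rewrite -ey.
by clear ex ey ex' ey'; subst x' y'; rewrite (R_disj Exy ka ka' Rp Rp').
Qed.

Lemma R_nonempty x y a : relE F x y -> kappa en x y a -> relR en x y a !=set0.
Proof.
move=> Exy ka; have nK := K_normal Exy.
have [c _ ec] := phi_coset Exy (coset_by_cosets (subH F x y) 1%g).
have [d _ ed] := enumK_coset Exy ka.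
exists (existT (grp F) x 1%g, existT (grp F) y (c * d)%g); apply/RP => //.
by rewrite -ec -ed coset_byM //; apply: coset_by_refl.
Qed.

Lemma basic_nonempty r : basic F en r -> r !=set0.
Proof. by case=> x [y [a [Exy ka ->]]]; apply: R_nonempty. Qed.

Lemma R_inj x y a x' y' a' : relE F x y -> kappa en x y a ->
  relE F x' y' -> kappa en x' y' a' -> relR en x y a = relR en x' y' a' ->
  [/\ x = x', y = y' & a = a'].
Proof.
move=> Exy ka Exy' ka' e; have [p Rp] := R_nonempty Exy ka.
have Rp' := Rp; rewrite e in Rp'.
have [ex ey] := R_tag Rp; have [ex' ey'] := R_tag Rp'.
have ? : x' = x by rewrite -ex.
have ? : y' = y by rewrite -ey.
by clear ex ey ex' ey'; subst x' y'; rewrite (R_disj Exy ka ka' Rp Rp').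
Qed.

Lemma basic_sub_bigcup r X : basic F en r -> X `<=` algA F en ->
  r `<=` \bigcup_(S in X) S -> exists2 S, X S & r `<=` S.
Proof.
move=> br XA rX; have [p rp] := basic_nonempty br.
have [S XS Sp] := rX _ rp; exists S => //.
have [Y Yb eS] := XA _ XS; move: Sp; rewrite eS => -[r' Yr' r'p].
rewrite (basic_disj br (Yb _ Yr') rp r'p); exact: bigcup_sup.
Qed.

Lemma algA_sub S : (forall p, S p -> exists r, [/\ basic F en r, r p & r `<=` S])
  -> algA F en S.
Proof.
move=> h; exists [set r | basic F en r /\ r `<=` S]; first by move=> r [].
apply/seteqP; split=> p; first by case/h=> r [br rp rS]; exists r.
by case=> r [_ rS] /rS.
Qed.

Lemma basic_algA r : basic F en r -> algA F en r.
Proof. by move=> br; apply: algA_sub => p rp; exists r; split. Qed.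

Lemma algA_bigcup X : X `<=` algA F en -> algA F en (\bigcup_(S in X) S).
Proof.
move=> XA; apply: algA_sub => p [S XS]; have [Y Yb eS] := XA _ XS.
rewrite {1}eS => -[r Yr rp]; exists r; split=> //; first exact: Yb.
apply: subset_trans (bigcup_sup XS); rewrite eS; exact: bigcup_sup.
Qed.

Lemma algA_cup S T : algA F en S -> algA F en T -> algA F en (S `|` T).
Proof.
move=> AS AT; have -> : S `|` T = \bigcup_(r in [set S; T]) r.
  by rewrite bigcup_setU !bigcup_set1.
by apply: algA_bigcup => r [] ->.
Qed.

Lemma algA_compl S : algA F en S -> algA F en (@unitE F `\` S).
Proof.
case=> Y Yb ->; apply: algA_sub => p [Ep nSp].
have [r br rp] := R_cover Ep; exists r; split=> // q rq; split.
  by case: br rq => x [y [a [Exy ka ->]]]; apply: R_unitE.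
case=> r' Yr' r'q; apply: nSp; exists r' => //.
by rewrite -(basic_disj br (Yb _ Yr') rq r'q).
Qed.

Lemma basic_algA_sub r S : basic F en r -> algA F en S ->
  forall p, r p -> S p -> r `<=` S.
Proof.
move=> br [Y Yb ->] p rp [r' Yr' r'p].
rewrite (basic_disj br (Yb _ Yr') rp r'p); exact: bigcup_sup.
Qed.

Lemma E_trans x y z : relE F x y -> relE F y z -> relE F x z.
Proof. by have [_ _ t] := E_equiv F; apply: t. Qed.

Lemma E_sym x y : relE F x y -> relE F y x.
Proof. by have [_ s _] := E_equiv F; apply: s. Qed.

Lemma E_refl x : relE F x x.
Proof. by have [s _ _] := E_equiv F; apply: s. Qed.

Lemma algA_otimes_basic x y z a b : relE F x y -> relE F y z ->
  algA F en (otimes_basic en x y z a b).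
Proof.
move=> Exy Eyz; apply: algA_sub => p [c [kc Hc] Rp].
exists (relR en x z c); split=> //.
  by exists x, z, c; split=> //; apply: E_trans Eyz.
by move=> q Rq; exists c.
Qed.

Lemma algA_otimes S T : algA F en (otimes F en S T).
Proof.
apply: algA_sub => p [x [y [z [a [b [[Exy Eyz ka kb] RS RT]]]]]].
move=> [c [kc Hc] Rp]; exists (relR en x z c); split=> //.
  by exists x, z, c; split=> //; apply: E_trans Eyz.
by move=> q Rq; exists x, y, z, a, b; split=> //; exists c.
Qed.

Lemma otimes_RR x y z a b : relE F x y -> relE F y z ->
  kappa en x y a -> kappa en y z b ->
  otimes F en (relR en x y a) (relR en y z b) = otimes_basic en x y z a b.
Proof.
move=> Exy Eyz ka kb; apply/seteqP; split=> p; last first.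
  by move=> Op; exists x, y, z, a, b; split.
have sub_eq r r' : basic F en r -> basic F en r' -> r `<=` r' -> r = r'.
  move=> br br' rr'; have [q rq] := basic_nonempty br.
  exact: basic_disj br br' rq (rr' _ rq).
move=> [x' [y' [z' [a' [b' [[Exy' Eyz' ka' kb']]]]]]].
move=> /sub_eq e1 /sub_eq e2.
have [] := R_inj Exy' ka' Exy ka.
  by apply: e1; [exists x', y', a'|exists x, y, a].
have [] := R_inj Eyz' kb' Eyz kb.
  by apply: e2; [exists y', z', b'|exists y, z, b].
by move=> *; subst.
Qed.

Lemma otimes_RR0 x y w z a b : relE F x y -> relE F w z ->
  kappa en x y a -> kappa en w z b -> y <> w ->
  otimes F en (relR en x y a) (relR en w z b) = set0.
Proof.
move=> Exy Ewz ka kb yw; rewrite -subset0 => p.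
move=> [x' [y' [z' [a' [b' [[Exy' Eyz' ka' kb'] s1 s2 _]]]]]].
have [q Rq] := R_nonempty Exy' ka'; have [q' Rq'] := R_nonempty Eyz' kb'.
apply: yw; have [_ <-] := R_tag (s1 _ Rq); have [_ ->] := R_tag Rq.
by have [<- _] := R_tag (s2 _ Rq'); have [-> _] := R_tag Rq'.
Qed.

Lemma otimes_bigcup X Y : X `<=` algA F en -> Y `<=` algA F en ->
  otimes F en (\bigcup_(S in X) S) (\bigcup_(T in Y) T) =
  \bigcup_(S in X) \bigcup_(T in Y) otimes F en S T.
Proof.
move=> XA YA; apply/seteqP; split=> p.
  move=> [x [y [z [a [b [[Exy Eyz ka kb]]]]]]].
  move=> /(basic_sub_bigcup _ XA) [|S XS RS]; first by exists x, y, a.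
  move=> /(basic_sub_bigcup _ YA) [|T YT RT]; first by exists y, z, b.
  by move=> ?; exists S => //; exists T => //; exists x, y, z, a, b.
case=> S XS [T YT [x [y [z [a [b [? RS RT ?]]]]]]].
exists x, y, z, a, b; split=> //.
  by apply: subset_trans RS _; apply: bigcup_sup.
by apply: subset_trans RT _; apply: bigcup_sup.
Qed.

Hypothesis sf : semi_frame F.

Lemma R_conv x y a : relE F x y -> kappa en x y a ->
  exists2 b, kappa en y x b & relR en y x b = ((relR en x y a)^-1)%relation.
Proof.
move=> Exy ka; have Eyx := E_sym Exy.
have [_ /(_ _ _ Exy) [eH eK phiK] _ _] := sf.
have [_ /(_ _ _ Eyx) [_ _ phiK'] _ _] := sf.
have nH := H_normal Exy; have nK := K_normal Exy.
have [u _ eu] := enumH_coset Exy ka.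
have [_ _ /(_ _ (coset_by_cosets (subH F x y) (u^-1)%g)) [b kb eb]] :=
  enumH_bij en Exy.
have kb' : kappa en y x b by rewrite (kappa_sym en Exy).
have [_ phiM] := phi_iso Exy.
exists b => //; apply/seteqP; split=> -[[y' h] [x' g]] /=.
all: move=> Rp; have /= [? ?] := R_tag Rp; subst x' y'.
all: move: Rp; rewrite (RP _ _ Exy ka) (RP _ _ Eyx kb').
all: rewrite /enumK (enumH_sym Exy kb) phiK; last exact: enumH_coset.
all: rewrite eb -eu -phiM ?coset_byM //; try exact: coset_by_cosets.
all: have [v _ ev] := phi_coset Eyx (coset_by_cosets (subH F y x) h).
all: rewrite eK in ev; rewrite -ev coset_byM //.
all: have ev' : phi F x y (coset_by (subH F x y) v) = coset_by (subK F x y) h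
  by rewrite ev phiK' ?eH //; rewrite -eH; apply: coset_by_cosets.
  move/(coset_by_eq nH) => e.
  have {}e : coset_by (subH F x y) v = coset_by (subH F x y) (g * u)%g.
    by rewrite -coset_byM // -e coset_byM // mulgVK.
  by rewrite -e ev'; apply: coset_by_refl.
have [w _ ew] := phi_coset Exy (coset_by_cosets (subH F x y) (g * u)%g).
rewrite -ew => /(coset_by_eq nK) e; rewrite e -ev' in ew.
have {}e : coset_by (subH F x y) v = coset_by (subH F x y) (g * u)%g.
  by apply: (phi_inj Exy); rewrite ?ew //; apply: coset_by_cosets.
rewrite -coset_byM // e coset_byM // mulgK; exact: coset_by_refl.
Qed.

Lemma algA_conv S : algA F en S -> algA F en (S^-1)%relation.
Proof.
case=> X Xb ->; apply: algA_sub => p [r Xr rp].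
have [x [y [a [Exy ka er]]]] := Xb _ Xr.
have [b kb eb] := R_conv Exy ka.
exists (relR en y x b); split; first by exists y, x, b; split=> //; apply: E_sym.
  by rewrite eb /= -er.
by rewrite eb -er => q rq; exists r.
Qed.

Lemma kappa_zero x y : relE F x y -> kappa en x y (ord_zero en).
Proof.
move=> Exy; have [_ _ /(_ _ (coset_by_cosets (subH F x y) 1%g)) [a ka _]] :=
  enumH_bij en Exy.
by apply: kappa_initial ka; apply: ord_zero_le.
Qed.

Lemma algA_diagonal : algA F en (@diagonal (carrierU F)).
Proof.
have key x g h : relR en x x (ord_zero en) (existT (grp F) x g, existT (grp F) x h)
    <-> g = h.
  have Exx := E_refl x; have [/(_ x) [eH eK ephi] _ _ _] := sf.
  rewrite (RP _ _ Exx (kappa_zero Exx)) /enumK (enumH_zero en Exx) eH.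
  rewrite !ephi; last 2 first.
  - by rewrite -eH; apply: cosets1.
  - exact: coset_by_cosets.
  split; first by case=> _ [_ [[_ -> <-] -> ->]]; rewrite !mulg1.
  move=> <-; exists g, 1%g; split; rewrite ?mulg1 //.
  by exists 1%g; rewrite ?mulg1.
apply: algA_sub => -[[x g] q] /diagonalP <-.
exists (relR en x x (ord_zero en)); split.
- by exists x, x, (ord_zero en); split=> //; [exact: E_refl|exact/kappa_zero/E_refl].
- exact/key.
move=> [[x1 g1] [x2 g2]] Rp; have /= [? ?] := R_tag Rp; subst x1 x2.
by apply/diagonalP; move/key: Rp => ->.
Qed.

End CosetRelationTheory.

(* Algebras of the similarity type of relation algebras. *)
Record algebra := Algebra {
  ra_car :> Type;
  ra_join : ra_car -> ra_car -> ra_car;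
  ra_compl : ra_car -> ra_car;
  ra_comp : ra_car -> ra_car -> ra_car;
  ra_conv : ra_car -> ra_car;
  ra_ident : ra_car }.

Definition isomorphic (B B' : algebra) : Prop :=
  exists f : B -> B',
    [/\ bijective f,
        forall s t, f (ra_join s t) = ra_join (f s) (f t),
        forall s, f (ra_compl s) = ra_compl (f s)
      & [/\ forall s t, f (ra_comp s t) = ra_comp (f s) (f t),
            forall s, f (ra_conv s) = ra_conv (f s)
          & f (ra_ident B) = ra_ident B']].

Definition direct_product (J : Type) (B : J -> algebra) : algebra :=
  @Algebra (forall j, B j)
    (fun s t j => ra_join (s j) (t j))
    (fun s j => ra_compl (s j))
    (fun s t j => ra_comp (s j) (t j))
    (fun s j => ra_conv (s j))
    (fun j => ra_ident (B j)).

Definition coset_algebra (F : group_triple) (sf : semi_frame F)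
    (en : coset_enumeration F) : algebra :=
  @Algebra {S | algA F en S}
    (fun s t => exist _ (sval s `|` sval t)
                        (algA_cup (svalP s) (svalP t)))
    (fun s => exist _ (@unitE F `\` sval s) (algA_compl (svalP s)))
    (fun s t => exist _ (otimes F en (sval s) (sval t))
                        (algA_otimes en (sval s) (sval t)))
    (fun s => exist _ ((sval s)^-1)%relation (algA_conv sf (svalP s)))
    (exist _ (@diagonal (carrierU F)) (algA_diagonal en sf)).

(* Main.v *)
Require Import Defs.
From mathcomp Require Import all_boot.
From mathcomp Require Import boolp classical_sets functions wochoice.
From Stdlib Require Import RelationClasses.

(** The factors are the restrictions of the semi-frame to the equivalence
    classes of [relE].  Every element of the algebra is contained in [unitE],
    which is the disjoint union of the squares over the classes, so it is
    determined by its traces on these squares; and no operation, [otimes]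
    included, relates indices in distinct classes, so that taking traces
    preserves all of them. *)

Set Implicit Arguments.
Unset Strict Implicit.
Unset Printing Implicit Defensive.

Local Open Scope classical_set_scope.

Lemma sig_eq (T : Type) (P : T -> Prop) (u v : {x | P x}) :
  sval u = sval v -> u = v.
Proof.
case: u v => [x px] [y py] /= e; subst y.
by rewrite (Prop_irrelevance px py).
Qed.

Section Restriction.
Variables (F : group_triple) (P : set (idx F)).

Lemma restrict_equiv :
  Equivalence (fun x y : {x | P x} => relE F (sval x) (sval y)).
Proof.
split; first by move=> x; apply: E_refl.
  by move=> x y; apply: E_sym.
by move=> x y z; apply: E_trans.
Qed.

(** All components at [x] are those of [F] at [sval x] by conversion, so each axiom is inherited by
    instantiation. *)
Definition restrict : group_triple :=
  @GroupTriple {x | P x} (fun x y => relE F (sval x) (sval y))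
    (fun x => grp F (sval x))
    (fun x y => subH F (sval x) (sval y))
    (fun x y => subK F (sval x) (sval y))
    (fun x y => phi F (sval x) (sval y))
    (fun x y z => cosC F (sval x) (sval y) (sval z))
    restrict_equiv
    (fun x y h => H_normal h)
    (fun x y h => K_normal h)
    (fun x y h => phi_iso h)
    (fun x y z h k => C_coset h k).

Lemma restrict_semi_frame : semi_frame F -> semi_frame restrict.
Proof.
case=> h1 h2 h3 h4; split.
- by move=> x; apply: h1.
- by move=> x y; apply: h2.
- by move=> x y z; apply: h3.
- by move=> x y z; apply: h4.
Qed.

Lemma restrict_coset_conditions :
  coset_conditions F -> coset_conditions restrict.
Proof.
case=> h1 h2 h3 h4; split.
- by move=> x y; apply: h1.
- by move=> x y z; apply: h2.
- by move=> x y z; apply: h3.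
- by move=> x y z w; apply: h4.
Qed.

Variable en : coset_enumeration F.

(** Keeping the ordinals and enumerations of [en] gives corresponding basic relations the same label
    [a]. *)
Definition restrict_enum : coset_enumeration restrict :=
  @CosetEnumeration restrict (ord en) (@ord_le F en) (ord_zero en)
    (fun x y => kappa en (sval x) (sval y))
    (fun x y => enumH en (sval x) (sval y))
    (@ord_wo F en) (@ord_zero_le F en)
    (fun x y a b => @kappa_initial F en (sval x) (sval y) a b)
    (fun x y h => enumH_bij en h)
    (fun x y h => enumH_zero en h)
    (fun x y h => kappa_sym en h)
    (fun x y a => @enumH_sym F en (sval x) (sval y) a).

Definition embed (u : carrierU restrict) : carrierU F :=
  existT (grp F) (sval (projT1 u)) (projT2 u).

Definition embed2 (p : carrierU restrict * carrierU restrict) :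
    carrierU F * carrierU F := (embed p.1, embed p.2).

Lemma embed_inj : injective embed.
Proof.
move=> [[x px] g] [[y py] h] e.
have exy : x = y := projT1_eq e.
subst y; have ? : px = py := Prop_irrelevance px py.
by subst py; have -> : g = h := existT_inj e.
Qed.

Lemma embed2_inj : injective embed2.
Proof.
move=> [u v] [u' v'] e; congr pair; apply: embed_inj.
  exact: (congr1 fst e).
exact: (congr1 snd e).
Qed.

Lemma embed2_onto p : P (projT1 p.1) -> P (projT1 p.2) ->
  exists q, embed2 q = p.
Proof.
case: p => -[x g] [y h] /= px py.
by exists (existT (grp restrict) (exist _ x px) g,
           existT (grp restrict) (exist _ y py) h).
Qed.

Lemma relR_embed x y a p : relR restrict_enum x y a p <->
  relR en (sval x) (sval y) a (embed2 p).
Proof.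
case: p => u v; split.
  by case=> c kc [/= [g Hg <-] [h Kh <-]]; exists c => //;
     split; [exists g|exists h].
case=> c kc [/= [g Hg eg] [h Kh eh]]; exists c => //; split.
  by exists g => //; apply: embed_inj.
by exists h => //; apply: embed_inj.
Qed.

Definition trace (S : set (carrierU F * carrierU F)) :
    set (carrierU restrict * carrierU restrict) := embed2 @^-1` S.

(** A basic relation lives on a single product of two groups; as both indices satisfy [P], all of it
    is in the range of [embed2] and the trace loses none of its pairs. *)
Lemma relR_sub_trace x y a S :
  relR restrict_enum x y a `<=` trace S <->
  relR en (sval x) (sval y) a `<=` S.
Proof.
split=> [h p Rp|h p /relR_embed /h//].
have [ex ey] := R_tag Rp.
have [||q eq] := @embed2_onto p; first by rewrite ex; apply: svalP.
  by rewrite ey; apply: svalP.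
by subst p; apply: h; apply/relR_embed.
Qed.

Lemma trace_algA S : algA F en S -> algA restrict restrict_enum (trace S).
Proof.
case=> X Xb ->; apply: algA_sub => p [r Xr rp].
have [x [y [a [Exy ka er]]]] := Xb _ Xr; subst r.
(* The indices of a basic relation meeting the range of [embed2] are tags coming from the
   restriction, so the relation is basic there as well. *)
have /= [ex ey] := R_tag rp; subst x y.
exists (relR restrict_enum (projT1 p.1) (projT1 p.2) a); split.
- by exists (projT1 p.1), (projT1 p.2), a.
- exact/relR_embed.
- move=> q /relR_embed Rq.
  by exists (relR en (sval (projT1 p.1)) (sval (projT1 p.2)) a).
Qed.

Lemma trace_diagonal : trace (@diagonal _) = @diagonal _.
Proof.
apply/seteqP; split=> -[u v].
  by move=> /diagonalP e; apply/diagonalP; apply: embed_inj.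
by move/diagonalP=> ->; apply/diagonalP.
Qed.

Lemma otimes_basic_embed x y z a b p :
  otimes_basic restrict_enum x y z a b p <->
  otimes_basic en (sval x) (sval y) (sval z) a b (embed2 p).
Proof.
by split=> -[c kc Rp]; exists c => //; apply/relR_embed.
Qed.

Hypothesis P_closed : forall x y, P x -> relE F x y -> P y.

(** A pair in the product shows only the outer indices of the two factors. The middle index [y] is
    related to the first one, and closure of [P] under [relE] brings it into the restriction. *)
Lemma trace_otimes S T :
  trace (otimes F en S T) = otimes restrict restrict_enum (trace S) (trace T).
Proof.
apply/seteqP; split=> p.
  move=> [x [y [z [a [b [[Exy Eyz ka kb] RS RT Op]]]]]].
  have [ex ez] : sval (projT1 p.1) = x /\ sval (projT1 p.2) = z.
    by case: Op => c _ /R_tag.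
  have py : P y by apply: P_closed Exy; rewrite -ex; apply: svalP.
  subst x z; exists (projT1 p.1), (exist _ y py), (projT1 p.2), a, b.
  by split=> //; [apply/relR_sub_trace|apply/relR_sub_trace
                 |apply/otimes_basic_embed].
move=> [x [y [z [a [b [[Exy Eyz ka kb]]]]]]].
move=> /relR_sub_trace RS /relR_sub_trace RT /otimes_basic_embed Op.
by exists (sval x), (sval y), (sval z), a, b.
Qed.

End Restriction.

Section Decomposition.
Variables (F : group_triple) (en : coset_enumeration F).

(** Taking classes as sets makes equality of classes extensional, with no choice of representatives.
    If [idx F] is empty there are no classes, and the product is the one-element algebra. *)
Definition E_class : Type := {X : set (idx F) | exists x, X = relE F x}.

Definition class_of (x : idx F) : E_class :=
  exist _ (relE F x) (ex_intro _ x erefl).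

Implicit Types j : E_class.

Lemma class_closed j x y : sval j x -> relE F x y -> sval j y.
Proof. by case: j => X /= [x0 ->]; apply: E_trans. Qed.

Lemma class_rel j x y : sval j x -> sval j y -> relE F x y.
Proof. by case: j => X /= [x0 ->] /E_sym; apply: E_trans. Qed.

Lemma class_eq j j' x : sval j x -> sval j' x -> j = j'.
Proof.
move=> jx j'x; apply: sig_eq; apply/seteqP; split=> y h.
  by apply: class_closed j'x _; apply: class_rel h.
by apply: class_closed jx _; apply: class_rel h.
Qed.

Lemma class_simple j : simple (restrict (sval j)).
Proof.
split; last by move=> [x jx] [y jy]; apply: class_rel jx jy.
have [x e] := svalP j.
have jx : sval j x by rewrite e; apply: E_refl.
by exists (exist _ x jx).
Qed.

Lemma algA_unitE S : algA F en S -> S `<=` @Defs.unitE F.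
Proof.
case=> X Xb -> p [r /Xb [x [y [a [Exy ka ->]]]]]; exact: R_unitE.
Qed.

Definition glue
    (T : forall j, set (carrierU (restrict (sval j)) *
                        carrierU (restrict (sval j)))) :
    set (carrierU F * carrierU F) := \bigcup_j (@embed2 F (sval j) @` T j).

Lemma glue_trace S : S `<=` @Defs.unitE F ->
  glue (fun j => trace (P := sval j) S) = S.
Proof.
move=> SE; apply/seteqP; split=> p; first by case=> j _ [q Sq <-].
move=> Sp; have Ep := SE _ Sp.
(* The class of the first tag serves for both: [Ep] puts the second tag in it. *)
have [||q eq] := @embed2_onto F (sval (class_of (projT1 p.1))) p => //.
  exact: E_refl.
exists (class_of (projT1 p.1)) => //; exists q => //.
by rewrite /trace /= eq.
Qed.

(** Classes sharing an index coincide, so a pair embedded from [j] can enter [glue T] only through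
    [T j]; injectivity of [embed2] then recovers it. *)
Lemma trace_glue T j : trace (P := sval j) (glue T) = T j.
Proof.
apply/seteqP; split=> p; last by move=> Tp; exists j => //; exists p.
case=> j' _ [q Tq e].
have jj' : j' = j.
  have e1 : sval (projT1 q.1) = sval (projT1 p.1).
    exact: (congr1 (fun r => projT1 r.1) e).
  apply: (@class_eq _ _ (sval (projT1 q.1))); first exact: svalP.
  rewrite e1; exact: svalP.
by subst j'; rewrite -(embed2_inj e).
Qed.

Lemma glue_algA T : (forall j, algA _ (restrict_enum (sval j) en) (T j)) ->
  algA F en (glue T).
Proof.
move=> AT; apply: algA_sub => p [j _ [q Tq <-]].
have [X Xb eT] := AT j; have Tq' := Tq; rewrite eT in Tq'.
case: Tq' => r Xr rq; have [x [y [a [Exy ka er]]]] := Xb _ Xr; subst r.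
exists (relR en (sval x) (sval y) a); split.
- by exists (sval x), (sval y), a.
- exact/relR_embed.
(* Inclusion in [glue T] can be tested on the trace at [j], which is [T j]. *)
- apply/(relR_sub_trace (P := sval j)); rewrite trace_glue eT.
  by move=> q' Rq; exists (relR (restrict_enum (sval j) en) x y a).
Qed.

End Decomposition.

Theorem theorem6p2 (F : group_triple) (sf : semi_frame F)
    (cc : coset_conditions F) (en : coset_enumeration F) :
  exists (J : Type) (F' : J -> group_triple)
    (sf' : forall j, semi_frame (F' j))
    (en' : forall j, coset_enumeration (F' j)),
    (forall j, simple (F' j) /\ coset_conditions (F' j)) /\
    isomorphic (coset_algebra sf en)
      (direct_product (fun j => coset_algebra (sf' j) (en' j))).
Proof.
exists (E_class F), (fun j => restrict (sval j)),
  (fun j => restrict_semi_frame (sval j) sf),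
  (fun j => restrict_enum (sval j) en); split.
  by move=> j; split; [exact: class_simple|exact: restrict_coset_conditions].
exists (fun S j => exist _ _ (trace_algA (sval j) (svalP S))).
split.
- exists (fun T => exist _ _ (glue_algA (fun j => svalP (T j)))).
  + move=> S; apply: sig_eq => /=.
    exact: glue_trace (algA_unitE (svalP S)).
  + move=> T; apply: functional_extensionality_dep => j; apply: sig_eq => /=.
    exact: (trace_glue (fun j => sval (T j))).
(* Preimages under [embed2] commute by computation with union, difference and converse, and the
   preimage of [unitE] is the [unitE] of the restriction. *)
- by move=> S T; apply: functional_extensionality_dep => j; apply: sig_eq.
- by move=> S; apply: functional_extensionality_dep => j; apply: sig_eq.
split.
- move=> S T; apply: functional_extensionality_dep => j; apply: sig_eq => /=.
  exact: trace_otimes (@class_closed F j) _ _.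
- by move=> S; apply: functional_extensionality_dep => j; apply: sig_eq.
- apply: functional_extensionality_dep => j; apply: sig_eq => /=.
  exact: trace_diagonal.
Qed.
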